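(* Let $0<a\le b\le2$, let $\alpha:\mathbf{R}\to[a,b]$ be continuous, let $0<H<1$, $\lambda>0$, and let $X_{H,\alpha(x),\lambda}$ be the linear tempered fractional multistable motion. There is a number $C$, depending only on $a,b,\lambda$ and $H$, such that for all $t,v\in\mathbf{R}$ and any $y>0$, $$\mathbf{P}\Big(\big|X_{H,\alpha(x),\lambda}(t)-X_{H,\alpha(x),\lambda}(v)\big|\ge y\Big)\le\frac{C}{y^a\wedge y^b}\Big(|t-v|^{Ha}+|t-v|^{Hb}\Big).$$ In particular, there is a number $C$, depending only on $a,b,\lambda$ and $H$, such that for any $\beta\in(0,Ha/b)$ and all $t,v\in\mathbf{R}$ with $0<|t-v|\le1$, $$\mathbf{P}\Big(\big|X_{H,\alpha(x),\lambda}(t)-X_{H,\alpha(x),\lambda}(v)\big|\ge|t-v|^\beta\Big)\le C|t-v|^{Ha-\beta b},$$ and consequently $X_{H,\alpha(x),\lambda}(t)$ is stochastic Hölder continuous of exponent $\beta$ for every $\beta\in(0,Ha/b)$.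
   Context: Conventions: $(x)_+=\max\{x,0\}$, $0^\gamma=0$ for all $\gamma\in\mathbf{R}$, and $u\wedge w=\min\{u,w\}$. Set $$G_{H,\alpha(x),\lambda}(t,x)=e^{-\lambda(t-x)_+}(t-x)_+^{H-\frac1{\alpha(x)}}-e^{-\lambda(-x)_+}(-x)_+^{H-\frac1{\alpha(x)}} .$$ The multistable stochastic integral $I(f)=\int f(x)\,dM_\alpha(x)$, defined for measurable $f$ with $\int_{-\infty}^\infty|f(x)|^{\alpha(x)}dx<\infty$, is specified by its finite-dimensional distributions: $\mathbf{E}[e^{i\sum_{k=1}^d\theta_kI(f_k)}]=\exp\{-\int_{-\infty}^\infty|\sum_{k=1}^d\theta_kf_k(x)|^{\alpha(x)}dx\}$. The linear tempered fractional multistable motion (LTFmSM) is $X_{H,\alpha(x),\lambda}(t)=\int_{-\infty}^\infty G_{H,\alpha(x),\lambda}(t,x)\,dM_\alpha(x)$, $t\in\mathbf{R}$; thus $$\mathbf{E}\Big[e^{i\sum_{k=1}^d\theta_kX_{H,\alpha(x),\lambda}(t_k)}\Big]=\exp\Big\{-\int_{-\infty}^\infty\Big|\sum_{k=1}^d\theta_kG_{H,\alpha(x),\lambda}(t_k,x)\Big|^{\alpha(x)}dx\Big\}.$$ A stochastic process $X(t)$, $t\in I$, is called stochastic Hölder continuous of exponent $\beta\in(0,\infty)$ if there is a constant $C>0$ such that $$\limsup_{t,v\in I,\ |t-v|\to0}\mathbf{P}\big(|X(t)-X(v)|\ge C|t-v|^\beta\big)=0,$$ where $t\neq v$ in the limit.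 *)

(* Defs.v *)
From HB Require Import structures.
From mathcomp Require Export all_boot all_order all_algebra.
From mathcomp Require Export complex.
From mathcomp Require Export all_classical all_reals all_analysis.
Export Order.TTheory GRing.Theory Num.Theory.
Export numFieldNormedType.Exports.

Set Implicit Arguments.
Unset Strict Implicit.
Unset Printing Implicit Defensive.

Local Open Scope classical_set_scope.
Local Open Scope ring_scope.

(* Real power with the convention 0 ^ g = 0 for every g.  The library's powR
   has 0 `^ 0 = 1, and the exponent H - 1 / alpha x may vanish. *)
Definition pow0 (R : realType) (x g : R) : R :=
  if x == 0 then 0 else x `^ g.

Definition pospart (R : realType) (x : R) : R := Num.max x 0.

Definition G (R : realType) (H : R) (alpha : R -> R) (lambda t x : R) : R :=
  expR (- lambda * pospart (t - x)) * pow0 (pospart (t - x)) (H - (alpha x)^-1)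
  - expR (- lambda * pospart (- x)) * pow0 (pospart (- x)) (H - (alpha x)^-1).

(* E[exp(i Y)], the expectation of a complex variable being taken on real and
   imaginary parts. *)
Definition expectation_expi d (T : measurableType d) (R : realType)
    (P : probability T R) (Y : T -> R) : R[i] :=
  (fine 'E_P[cos \o Y] +i* fine 'E_P[sin \o Y])%C.

(* The measurable functions f such that |f x| `^ alpha x is integrable. *)
Definition variable_Lalpha (R : realType) (alpha : R -> R) : set (R -> R) :=
  [set f : R -> R | measurable_fun setT f /\
    (\int[@lebesgue_measure R]_x (`|f x| `^ alpha x)%:E < +oo)%E].

(* I is a version of the stochastic integral f |-> \int f dM_alpha, viewed as a
   process indexed by variable_Lalpha alpha and specified by its
   finite-dimensional distributions; I f is unconstrained for other f. *)
Definition multistable_integral d (T : measurableType d) (R : realType)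
    (P : probability T R) (alpha : R -> R) (I : (R -> R) -> {RV P >-> R}) :=
  forall (n : nat) (f : 'I_n -> R -> R) (theta : 'I_n -> R),
    (forall k, variable_Lalpha alpha (f k)) ->
    expectation_expi P (fun w => \sum_(k < n) theta k * I (f k) w) =
    ((expR (- \int[@lebesgue_measure R]_x
                (`|\sum_(k < n) theta k * f k x| `^ alpha x))%R)%:C)%C.

Definition LTFmSM d (T : measurableType d) (R : realType)
    (P : probability T R) (H : R) (alpha : R -> R) (lambda : R)
    (X : R -> {RV P >-> R}) :=
  exists2 I : (R -> R) -> {RV P >-> R},
    multistable_integral alpha I &
    forall t, {ae P, forall w, X t w = I (G H alpha lambda t) w}.

(* The limsup is taken along pairs t, v of distinct points of J with
   |t - v| -> 0: the uniformity of R is the filter generated by the sets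
   {(t, v) : |t - v| < e}. *)
Definition stochastic_Holder d (T : measurableType d) (R : realType)
    (P : probability T R) (J : set R) (X : R -> {RV P >-> R}) (beta : R) :=
  exists2 C : R, 0 < C &
    limf_esup
      (fun p : R * R =>
         P [set w | C * `|p.1 - p.2| `^ beta <= `|X p.1 w - X p.2 w|])
      (within [set p : R * R | [/\ J p.1, J p.2 & p.1 != p.2]] entourage)
    = 0%E.

(* Main.v *)
(** The increment [X t - X v] has characteristic function
    [exp (- \int |theta (G t - G v)|^alpha)], so everything rests on a bound of
    [\int |G t - G v|^alpha] by a constant times [|t - v|^(H a) + |t - v|^(H b)].
    With [h = |t - v|], at distance less than [2 h] the two kernels are estimated
    separately by the integrable singularity [s^(H alpha - 1)]; at distance [s >= h]
    the mean value theorem for the logarithm of the kernel gains a factor [h / s],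
    and [exp (- lambda s) (lambda s + K) <= 1 + K] makes the bound independent of
    [lambda].  Both majorants decay geometrically along dyadic annuli, which turns
    the integrals into geometric series with ratios [2^(- H a)] and
    [2^(- (1 - H) a)].  The tail of [X t - X v] is then recovered from the
    characteristic function at the points [2^(- k) / y]. *)

Require Import Defs.
From mathcomp Require Import ring lra measurable_realfun.

Set Implicit Arguments.
Unset Strict Implicit.
Unset Printing Implicit Defensive.

Local Open Scope classical_set_scope.
Local Open Scope ring_scope.

(** * Dyadic scales and geometric series *)

(** Take the least [k] with [x < 2 ^+ k.+1]: minimality gives the lower bound, except for [k = 0],
    where it is the hypothesis [1 <= x]. *)
Lemma dyadic_interval (R : realType) (x : R) :
  1 <= x -> exists k : nat, 2 ^+ k <= x /\ x <= 2 * 2 ^+ k.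
Proof.
move=> x1.
have exk : exists k : nat, x < 2 ^+ k.+1.
  exists (Num.truncn x); rewrite (lt_le_trans (truncnS_gt x))//.
  by rewrite -natrX ler_nat ltnW// ltn_expl.
case: (ex_minnP exk) => -[|k] xk kmin.
  by exists 0%N; rewrite expr0 mulr1; split => //; rewrite -[2]expr1 ltW.
exists k.+1; rewrite -exprS; split; last exact: ltW.
by rewrite leNgt; apply/negP => /kmin; rewrite ltnn.
Qed.

Lemma nneseries_geometric (R : realType) (s q : R) : 0 <= s -> 0 <= q < 1 ->
  (\sum_(0 <= k <oo) (s * q ^+ k)%:E = (s / (1 - q))%:E)%E.
Proof.
move=> s0 /andP[q0 q1]; apply/cvg_lim => //.
have := @cvg_geometric_series R s q; rewrite ger0_norm// => /(_ q1) sq.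
rewrite [X in X @ _ --> _](_ : _ = EFin \o series (geometric s q)).
  exact: cvg_comp sq _.
by apply/funext => n /=; rewrite -sumEFin.
Qed.

(** * Step functions on annuli to the left of a centre *)

Section annuli.
Context {R : realType}.
Implicit Types (c x : R) (r w : nat -> R).

(** The [k]-th interval has length [r k], so the height [w k / r k] makes [w k] its contribution to
    the integral. Only the left side of [c] matters, since the kernel vanishes on the right; values
    in [\bar R] allow overlaps and divergence. *)
Definition annuli c r w x : \bar R :=
  (\sum_(0 <= k <oo)
     (w k / r k)%:E * (\1_(`[c - 2 * r k, c - r k]%classic : set R) x)%:E)%E.

Lemma annuli_term_ge0 c r w x k : 0 < r k -> 0 <= w k ->
  (0 <= (w k / r k)%:E *
        (\1_(`[c - 2 * r k, c - r k]%classic : set R) x)%:E)%E.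
Proof. by move=> r0 w0; rewrite -EFinM lee_fin mulr_ge0// divr_ge0// ltW. Qed.

Lemma annuli_ge0 c r w x : (forall k, 0 < r k) -> (forall k, 0 <= w k) ->
  (0 <= annuli c r w x)%E.
Proof. by move=> r0 w0; apply: nneseries_ge0 => k _ _; exact: annuli_term_ge0. Qed.

Lemma measurable_annuli c r w : (forall k, 0 < r k) -> (forall k, 0 <= w k) ->
  measurable_fun setT (annuli c r w).
Proof.
move=> r0 w0; apply: ge0_emeasurable_sum => [k x _ _|k _].
  exact: annuli_term_ge0.
apply: emeasurable_funM => //; apply/measurable_EFinP.
exact: measurable_indic.
Qed.

Lemma annuli_ge c r w x k : (forall k, 0 < r k) -> (forall k, 0 <= w k) ->
  r k <= c - x <= 2 * r k -> ((w k / r k)%:E <= annuli c r w x)%E.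
Proof.
move=> r0 w0 /andP[rx xr].
have ge0 j (_ : (0 <= j)%N) (_ : xpredT j) := @annuli_term_ge0 c r w x j (r0 j) (w0 j).
(* The partial sum of [k.+1] terms is the first one that contains the term of index [k]. *)
apply: le_trans (nneseries_lim_ge k.+1 ge0).
rewrite big_nat_recr//= -[leLHS]add0e leeD//.
  by apply: sume_ge0 => j _; exact: ge0.
rewrite indicE mem_set ?mule1//= in_itv/=; apply/andP; split; lra.
Qed.

Lemma integral_annuli c r w : (forall k, 0 < r k) -> (forall k, 0 <= w k) ->
  (\int[@lebesgue_measure R]_x annuli c r w x = \sum_(0 <= k <oo) (w k)%:E)%E.
Proof.
move=> r0 w0; rewrite integral_nneseries//; last 2 first.
- move=> k; apply: emeasurable_funM => //; apply/measurable_EFinP.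
  exact: measurable_indic.
- by move=> k x _; exact: annuli_term_ge0.
apply: eq_eseriesr => k _.
rewrite ge0_integralZl//; last 2 first.
- by apply/measurable_EFinP; exact: measurable_indic.
- by rewrite lee_fin divr_ge0// ltW.
rewrite integral_indic// setIT/= lebesgue_measure_itv/= lte_fin.
have -> : c - 2 * r k < c - r k by move: (r0 k); lra.
rewrite -EFinD -EFinM; congr EFin; field.
by rewrite gt_eqF.
Qed.

End annuli.

(** * Powers with variable exponent, measurability, and the kernel *)

(** The exponent [b] dominates for [x >= 1] and [a] for [x < 1]. This turns a power with exponent
    depending on [alpha x] into the two-term bound of the theorem. *)
Lemma powR_le_sum (R : realType) (x a b p : R) :
  0 <= x -> 0 < a -> a <= p <= b -> x `^ p <= x `^ a + x `^ b.
Proof.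
move=> x0 a0 /andP[ap pb].
have [x1|x1] := leP 1 x.
  by rewrite (le_trans (ler_powR x1 pb))// lerDr powR_ge0.
move: x0; rewrite le_eqVlt => /predU1P[<-|x0].
  by rewrite powR0 ?addr_ge0 ?powR_ge0// gt_eqF// (lt_le_trans a0).
by rewrite (le_trans (ger_powR _ ap)) ?lerDl ?powR_ge0// x0 ltW.
Qed.

Lemma powR_ge_min (R : realType) (y a b p : R) :
  0 < y -> a <= p <= b -> Num.min (y `^ a) (y `^ b) <= y `^ p.
Proof.
move=> y0 /andP[ap pb]; rewrite ge_min; have [y1|y1] := leP 1 y.
  by rewrite ler_powR.
by rewrite (ger_powR _ pb) ?orbT// y0 ltW.
Qed.

Lemma measurable_pow0 d (T : measurableType d) (R : realType) (u w : T -> R) :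
  measurable_fun setT u -> measurable_fun setT w ->
  measurable_fun setT (fun x => pow0 (u x) (w x)).
Proof.
move=> mu mw; apply: measurable_fun_ifT => //.
  exact: measurable_fun_eqr.
rewrite /powR; apply: measurable_fun_ifT => //.
- exact: measurable_fun_eqr.
- apply: (measurableT_comp (f := fun b : bool => (b%:R : R))) => //.
  exact: measurable_fun_eqr.
- apply: measurableT_comp => //; apply: measurable_funM => //.
  exact: measurableT_comp.
Qed.

(** The two power functions differ only at base 0 with exponent 0, so measurability carries over
    from [pow0] when the exponent never vanishes. *)
Lemma measurable_powR_var d (T : measurableType d) (R : realType)
    (u w : T -> R) : (forall x, w x != 0) ->
  measurable_fun setT u -> measurable_fun setT w ->
  measurable_fun setT (fun x => u x `^ w x).
Proof.
move=> w0 mu mw.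
rewrite [X in measurable_fun _ X](_ : _ = fun x => pow0 (u x) (w x)).
  exact: measurable_pow0.
apply/funext => x; rewrite /pow0; case: eqP => // ->.
by rewrite powR0.
Qed.

Lemma measurable_pospart (R : realType) : measurable_fun setT (@pospart R).
Proof. exact: measurable_maxr. Qed.

Lemma measurable_invr_continuous (R : realType) (f : R -> R) :
  (forall x, f x != 0) -> continuous f -> measurable_fun setT (fun x => (f x)^-1).
Proof.
move=> f0 cf; apply: continuous_measurable_fun => x.
by apply: cvgV; [exact: f0|exact: cf].
Qed.

(* The summand of [G] that depends on [t]; the other one is its value at [t = 0]. *)
Definition tempered_kernel (R : realType) (H : R) (alpha : R -> R)
    (lambda t x : R) : R :=
  expR (- lambda * pospart (t - x)) * pow0 (pospart (t - x)) (H - (alpha x)^-1).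

Lemma tempered_kernelB (R : realType) (H : R) (alpha : R -> R)
    (lambda t v x : R) :
  G H alpha lambda t x - G H alpha lambda v x =
  tempered_kernel H alpha lambda t x - tempered_kernel H alpha lambda v x.
Proof. by rewrite /G /tempered_kernel; ring. Qed.

Lemma G_tempered_kernel (R : realType) (H : R) (alpha : R -> R) (lambda t x : R) :
  G H alpha lambda t x =
  tempered_kernel H alpha lambda t x - tempered_kernel H alpha lambda 0 x.
Proof. by rewrite /G /tempered_kernel sub0r. Qed.

Lemma measurable_tempered_kernel (R : realType) (H : R) (alpha : R -> R)
    (lambda t : R) :
  (forall x, alpha x != 0) -> continuous alpha ->
  measurable_fun setT (tempered_kernel H alpha lambda t).
Proof.
move=> al0 cal.
have mp : measurable_fun setT (fun x : R => pospart (t - x)).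
  by apply: (measurableT_comp (@measurable_pospart R)); exact: measurable_funB.
apply: measurable_funM.
  by apply: measurableT_comp => //; exact: measurable_funM.
apply: measurable_pow0 => //; apply: measurable_funB => //.
exact: measurable_invr_continuous.
Qed.

Lemma tempered_kernel_ge0 (R : realType) (H : R) (alpha : R -> R)
    (lambda t x : R) : 0 <= tempered_kernel H alpha lambda t x.
Proof.
rewrite /tempered_kernel mulr_ge0 ?expR_ge0//.
by rewrite /pow0; case: ifP => // _; exact: powR_ge0.
Qed.

Lemma tempered_kernel_right (R : realType) (H : R) (alpha : R -> R)
    (lambda t x : R) : t <= x -> tempered_kernel H alpha lambda t x = 0.
Proof.
move=> tx; rewrite /tempered_kernel /pospart max_r ?subr_le0//.
by rewrite /pow0 eqxx mulr0.
Qed.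

(** The logarithmic form is the one to which the mean value estimate applies, and in which raising
    to the power [alpha x] is a multiplication. *)
Lemma tempered_kernel_left (R : realType) (H : R) (alpha : R -> R)
    (lambda t x : R) : x < t ->
  tempered_kernel H alpha lambda t x =
  expR (- lambda * (t - x) + (H - (alpha x)^-1) * ln (t - x)).
Proof.
move=> xt; have s0 : 0 < t - x by rewrite subr_gt0.
rewrite /tempered_kernel /pospart max_l ?ltW// /pow0 gt_eqF// expRD.
by rewrite /powR gt_eqF.
Qed.

(** * Elementary estimates for exponentials *)

(** The base is at most 1, so lowering the exponent to its uniform bound [c] enlarges the power and
    leaves a geometric sequence independent of [e]. *)
Lemma powR_half_exp (R : realType) (k : nat) (e c : R) : c <= e ->
  (2^-1 ^+ k) `^ e <= ((2 : R) `^ (- c)) ^+ k.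
Proof.
move=> ce; have h0 : 0 <= (2^-1 : R) ^+ k by rewrite exprn_ge0.
rewrite (@le_trans _ _ ((2^-1 ^+ k) `^ c))//.
  by apply: ger_powR => //; rewrite exprn_gt0//= exprn_ile1//; lra.
rewrite -(powR_mulrn k (_ : 0 <= 2^-1))// -(powR_mulrn k (powR_ge0 2 (- c))).
have -> : (2^-1 : R) = 2 `^ (-1) by rewrite powR_inv1.
rewrite -!powRrM.
by rewrite le_eqVlt; apply/orP; left; apply/eqP; congr powR; ring.
Qed.

Lemma powR2_lt1 (R : realType) (c : R) : 0 < c -> 0 <= (2 : R) `^ (- c) < 1.
Proof.
move=> c0; rewrite powR_ge0/=.
rewrite -[X in X `^ _](@lnK R 2) ?posrE// -expRM expR_lt1.
by rewrite mulrN oppr_lt0 mulr_gt0// ln_gt0//; lra.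
Qed.

(** Mean value inequality for the exponential, obtained from [1 + u <= expR u] at [u = B - A] when
    [B <= A]. *)
Lemma expR_dist (R : realType) (A B : R) :
  `|expR A - expR B| <= `|A - B| * Num.max (expR A) (expR B).
Proof.
wlog AB : A B / B <= A => [hw|].
  have [|/ltW] := leP B A; first exact: hw.
  by move=> /hw; rewrite distrC maxC (distrC B A).
have eAB : expR B <= expR A by rewrite ler_expR.
rewrite max_l// !ger0_norm ?subr_ge0//.
have := expR_ge1Dx (B - A); rewrite expRB ler_pdivlMr ?expR_gt0//; lra.
Qed.

(** Since [1 + u <= expR u], the product of [1 + K] with [expR u] is at least [u + K]. Used with
    [u = lambda * s], it removes [lambda] from the constants. *)
Lemma tempered_factor_le (R : realType) (u K : R) : 0 <= u -> 0 <= K ->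
  expR (- u) * (u + K) <= 1 + K.
Proof.
move=> u0 K0; rewrite expRN mulrC ler_pdivrMr ?expR_gt0//.
have := expR_ge1Dx u => /(ler_wpM2l (_ : 0 <= 1 + K)); rewrite addr_ge0//.
move=> /(_ isT); apply: le_trans; nra.
Qed.

(** * Pointwise majorants of the kernel near and far from the singularity *)

Section kernel_pointwise.
Context {R : realType}.
Variables (a b H lambda : R) (alpha : R -> R).
Hypotheses (a_gt0 : 0 < a) (b_le2 : b <= 2) (H_gt0 : 0 < H) (H_lt1 : H < 1)
  (lambda_ge0 : 0 <= lambda) (alpha_ab : forall x, a <= alpha x <= b).

Local Notation g := (tempered_kernel H alpha lambda).
Local Notation W h := (h `^ (H * a) + h `^ (H * b)).

Let alpha_gt0 x : 0 < alpha x.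
Proof. by case/andP: (alpha_ab x) => /(lt_le_trans a_gt0). Qed.

Let alpha_le2 x : alpha x <= 2.
Proof. by case/andP: (alpha_ab x) => _ /le_trans; exact. Qed.

Let scaleW (h : R) x : 0 < h -> h `^ (H * alpha x) <= W h.
Proof.
move=> h0; apply: powR_le_sum; [exact: ltW|exact: mulr_gt0|].
by rewrite !ler_pM2l.
Qed.

(** Near annuli cover the distances in []0, 2 * h]], far annuli those at least [h]. In the weights,
    4 bounds the power [H * alpha x] of 2, and the square bounds the power [alpha x] of the constant
    in [far_kernel_diff_le], because [H < 1] and [alpha x <= 2]. *)
Definition near_radius (h : R) (k : nat) : R := h * 2^-1 ^+ k.
Definition far_radius (h : R) (k : nat) : R := h * 2 ^+ k.
Definition near_weight (h : R) (k : nat) : R :=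
  4 * W h * (2 `^ (- (H * a))) ^+ k.
Definition far_weight (h : R) (k : nat) : R :=
  (2 * (2 + a^-1)) ^+ 2 * W h * (2 `^ (- ((1 - H) * a))) ^+ k.

Lemma near_kernel_le (h t x : R) : 0 < h -> t - x <= 2 * h ->
  ((g t x `^ alpha x)%:E <= annuli t (near_radius h) (near_weight h) x)%E.
Proof.
move=> h0 txh.
have r0 k : 0 < near_radius h k by rewrite mulr_gt0// exprn_gt0.
have W0 : 0 <= W h by rewrite addr_ge0 ?powR_ge0.
have w0 k : 0 <= near_weight h k by rewrite mulr_ge0 ?exprn_ge0 ?powR_ge0// mulr_ge0.
have [tx|xt] := leP t x.
  by rewrite tempered_kernel_right// powR0 ?gt_eqF//; exact: annuli_ge0.
set s := t - x; have s0 : 0 < s by rewrite subr_gt0.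
(* The ratio [2 * h / s] is at least 1, and its dyadic scale [k] is the one whose near annulus
   contains [x]. *)
have [|k [kl ku]] := @dyadic_interval R (2 * h / s); first by rewrite ler_pdivlMr ?mul1r.
have rs : near_radius h k <= s.
  rewrite /near_radius exprVn ler_pdivrMr ?exprn_gt0// mulrC.
  by move: ku; rewrite ler_pdivrMr//; lra.
have sr : s <= 2 * near_radius h k.
  rewrite /near_radius exprVn mulrA ler_pdivlMr ?exprn_gt0//.
  by move: kl; rewrite ler_pdivlMr// mulrC.
apply: le_trans (@annuli_ge _ t _ _ x k r0 w0 _); last by apply/andP.
rewrite lee_fin tempered_kernel_left// -/s -expRM.
(* Multiplying [H - (alpha x)^-1] by [alpha x] gives [H * alpha x - 1]; the tempering factor is at
   most 1 and is dropped. *)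
apply: (@le_trans _ _ (s `^ (H * alpha x) / s)).
  rewrite /powR gt_eqF// -[X in _ <= _ / X](lnK (_ : s \in Num.pos)) ?posrE//.
  rewrite -expRB ler_expR.
  have -> : (- lambda * s + (H - (alpha x)^-1) * ln s) * alpha x =
      - (lambda * s * alpha x) + (H * alpha x * ln s - ln s).
    by field; rewrite gt_eqF.
  by rewrite gerDr oppr_le0 !mulr_ge0//; exact: ltW.
apply: ler_pM; rewrite ?powR_ge0 ?invr_ge0 ?(ltW s0)//; last by rewrite lef_pV2 ?posrE.
apply: (@le_trans _ _ ((2 * near_radius h k) `^ (H * alpha x))).
  by apply: ge0_ler_powR; rewrite ?nnegrE ?(ltW s0) ?mulr_ge0 ?exprn_ge0 ?(ltW h0)
    ?(ltW H_gt0) ?(ltW (alpha_gt0 x)).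
rewrite /near_radius powRM ?powRM ?mulr_ge0 ?exprn_ge0 ?(ltW h0)//.
rewrite mulrA; apply: ler_pM; rewrite ?mulr_ge0 ?powR_ge0//; last first.
  by apply: powR_half_exp; rewrite ler_pM2l//; case/andP: (alpha_ab x).
apply: ler_pM; rewrite ?powR_ge0 ?scaleW//.
have -> : (4 : R) = 2 `^ 2%:R by rewrite powR_mulrn// expr2; lra.
rewrite ler_powR ?ler1n// (le_trans _ (alpha_le2 x))// ler_piMl ?(ltW H_lt1)//.
exact: ltW.
Qed.

(** With [A] and [B] the logarithms of the two kernels, [expR_dist] applies: [A - B] carries the
    gain [h / s], and the larger kernel is at most twice the one at [v]. *)
Lemma far_kernel_diff_le (h v x : R) : 0 < h -> h <= v - x ->
  `|g (v + h) x - g v x| <=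
  2 * (2 + a^-1) * (h / (v - x)) * (v - x) `^ (H - (alpha x)^-1).
Proof.
move=> h0; set s := v - x => hs; have s0 : 0 < s by exact: lt_le_trans hs.
have vs : v + h - x = s + h by rewrite /s; ring.
have xv : x < v by rewrite -subr_gt0.
rewrite (tempered_kernel_left _ _ _ xv) tempered_kernel_left; last by lra.
rewrite vs -/s; pose kp : R := H - (alpha x)^-1; rewrite -/kp.
have ai0 : 0 < (alpha x)^-1 by rewrite invr_gt0.
have aia : (alpha x)^-1 <= a^-1 by rewrite lef_pV2 ?posrE//; case/andP: (alpha_ab x).
have H0 := H_gt0; have H1 := H_lt1.
have kp1 : kp <= 1 by rewrite /kp; lra.
have kpK : `|kp| <= 1 + a^-1 by rewrite ler_norml /kp; apply/andP; split; lra.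
have hs1 : 0 < h / s <= 1 by rewrite divr_gt0//= ler_pdivrMr// mul1r.
have lnD : ln (s + h) = ln s + ln (1 + h / s).
  rewrite -lnM ?posrE//; last by case/andP: hs1 => ? _; lra.
  by congr ln; field; rewrite gt_eqF.
have l0 : 0 <= ln (1 + h / s) by apply: ln_ge0; case/andP: hs1; lra.
have lh : ln (1 + h / s) <= h / s by apply: le_ln1Dx; case/andP: hs1; lra.
have l2 : ln (1 + h / s) <= ln 2 by rewrite ler_ln ?posrE; case/andP: hs1; lra.
pose A : R := - lambda * (s + h) + kp * ln (s + h).
pose B : R := - lambda * s + kp * ln s.
rewrite -/A -/B.
have AB : A - B = - (lambda * h) + kp * ln (1 + h / s) by rewrite /A /B lnD; ring.
(* The bound holds for [kp] of either sign, as only [kp <= 1] and [1 + h / s <= 2] enter. *)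
have AB2 : A <= B + ln 2.
  have : kp * ln (1 + h / s) <= 1 * ln (1 + h / s) by rewrite ler_wpM2r.
  have : 0 <= lambda * h by rewrite mulr_ge0// ltW.
  move: AB l2; lra.
have mx : Num.max (expR A) (expR B) <= 2 * expR B.
  rewrite ge_max; apply/andP; split; last by have := expR_gt0 B; lra.
  by rewrite -[2]lnK ?posrE// -expRD ler_expR addrC.
(* Writing [lambda * h] as [h / s] times [lambda * s] lets the factor [h / s] come out of both
   terms; the rest is later absorbed by [tempered_factor_le]. *)
have dAB : `|A - B| <= h / s * (lambda * s + (1 + a^-1)).
  rewrite AB; apply: (le_trans (ler_normD _ _)).
  rewrite normrN !normrM (ger0_norm lambda_ge0) (ger0_norm (ltW h0)) (ger0_norm l0).
  have -> : h / s * (lambda * s + (1 + a^-1)) = lambda * h + (1 + a^-1) * (h / s).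
    by field; rewrite !gt_eqF.
  by rewrite lerD2l ler_pM.
apply: (le_trans (expR_dist A B)).
apply: (le_trans (ler_pM _ _ dAB mx)) => //.
have -> : B = - (lambda * s) + kp * ln s by rewrite /B mulNr.
rewrite expRD.
have -> : s `^ kp = expR (kp * ln s) by rewrite /powR gt_eqF.
have tf : expR (- (lambda * s)) * (lambda * s + (1 + a^-1)) <= 2 + a^-1.
  rewrite -[X in _ <= X](_ : 1 + (1 + a^-1) = _); last by ring.
  by apply: tempered_factor_le; [rewrite mulr_ge0// ltW|rewrite addr_ge0// invr_ge0 ltW].
rewrite [leLHS](_ : _ = expR (- (lambda * s)) * (lambda * s + (1 + a^-1)) *
  (2 * (h / s) * expR (kp * ln s))); last by ring.
rewrite [leRHS](_ : _ = (2 + a^-1) * (2 * (h / s) * expR (kp * ln s))); last by ring.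
rewrite ler_wpM2r// mulr_ge0 ?expR_ge0// mulr_ge0//.
by case/andP: hs1 => /ltW.
Qed.

Lemma far_kernel_le (h v x : R) : 0 < h -> h <= v - x ->
  ((`|g (v + h) x - g v x| `^ alpha x)%:E <=
    annuli v (far_radius h) (far_weight h) x)%E.
Proof.
move=> h0 hs.
have r0 k : 0 < far_radius h k by rewrite mulr_gt0// exprn_gt0.
have W0 : 0 <= W h by rewrite addr_ge0 ?powR_ge0.
have w0 k : 0 <= far_weight h k.
  by rewrite /far_weight mulr_ge0 ?exprn_ge0 ?powR_ge0//; apply: mulr_ge0; rewrite ?sqr_ge0.
have := far_kernel_diff_le h0 hs.
set s := v - x in hs *; have s0 : 0 < s by exact: lt_le_trans hs.
set L := 2 * (2 + a^-1) => dle.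
have a0 : 0 < a^-1 by rewrite invr_gt0.
have L1 : 1 <= L by rewrite /L; lra.
have L0 : 0 <= L by lra.
have [|k [kl ku]] := @dyadic_interval R (s / h); first by rewrite ler_pdivlMr ?mul1r.
have rs : far_radius h k <= s.
  by rewrite /far_radius mulrC; move: kl; rewrite ler_pdivlMr.
have sr : s <= 2 * far_radius h k.
  by move: ku; rewrite ler_pdivrMr// /far_radius; lra.
apply: le_trans (@annuli_ge _ v _ _ x k r0 w0 _); last by apply/andP.
have al0 := ltW (alpha_gt0 x).
have hs0 : 0 <= h / s by rewrite divr_ge0// ltW.
rewrite lee_fin; apply: (@le_trans _ _
    ((L * (h / s) * s `^ (H - (alpha x)^-1)) `^ alpha x)).
  by apply: ge0_ler_powR => //; rewrite nnegrE// mulr_ge0 ?powR_ge0// mulr_ge0.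
rewrite (powRM _ (mulr_ge0 L0 hs0) (powR_ge0 _ _)) (powRM _ L0 hs0) -powRrM.
have -> : L `^ alpha x * (h / s) `^ alpha x * s `^ ((H - (alpha x)^-1) * alpha x) =
    L `^ alpha x * h `^ (H * alpha x) * (h / s) `^ ((1 - H) * alpha x) / s.
  have -> : h `^ (H * alpha x) = (h / s) `^ (H * alpha x) * s `^ (H * alpha x).
    by rewrite -powRM ?(ltW s0)// divfK// gt_eqF.
  have -> : (H - (alpha x)^-1) * alpha x = H * alpha x - 1 by field; rewrite gt_eqF.
  have -> : s `^ (H * alpha x - 1) = s `^ (H * alpha x) / s.
    by rewrite powRB ?(gt_eqF s0) ?implybT// powRr1// ltW.
  have -> : (h / s) `^ alpha x =
      (h / s) `^ (H * alpha x) * (h / s) `^ ((1 - H) * alpha x).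
    rewrite -powRD; first by congr powR; ring.
    by rewrite (gt_eqF (divr_gt0 h0 s0)) implybT.
  by ring.
apply: ler_pM; rewrite ?mulr_ge0 ?powR_ge0 ?invr_ge0 ?(ltW s0)//; last first.
  by rewrite lef_pV2 ?posrE.
apply: ler_pM; rewrite ?mulr_ge0 ?powR_ge0//.
  apply: (ler_pM (powR_ge0 _ _) (powR_ge0 _ _) _ (scaleW _ h0)).
  by rewrite -(powR_mulrn 2 L0); apply: ler_powR.
apply: (@le_trans _ _ ((2^-1 ^+ k) `^ ((1 - H) * alpha x))).
  apply: ge0_ler_powR; rewrite ?nnegrE ?exprn_ge0//.
    by rewrite mulr_ge0// subr_ge0 ltW.
  rewrite ler_pdivrMr// exprVn mulrC ler_pdivlMr ?exprn_gt0//.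
apply: powR_half_exp; rewrite ler_pM2l ?subr_gt0//; case/andP: (alpha_ab x) => //.
Qed.

End kernel_pointwise.

(** * Integral of the kernel difference *)

Section kernel_integral.
Context {R : realType}.
Variables (a b H lambda : R) (alpha : R -> R).
Hypotheses (a_gt0 : 0 < a) (b_le2 : b <= 2) (H_gt0 : 0 < H) (H_lt1 : H < 1)
  (lambda_ge0 : 0 <= lambda) (alpha_ab : forall x, a <= alpha x <= b)
  (alpha_cont : continuous alpha).

Local Notation g := (tempered_kernel H alpha lambda).
Local Notation W h := (h `^ (H * a) + h `^ (H * b)).

Let alpha_gt0 x : 0 < alpha x.
Proof. by case/andP: (alpha_ab x) => /(lt_le_trans a_gt0). Qed.

Let alpha_neq0 x : alpha x != 0.
Proof. by rewrite gt_eqF. Qed.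

Let measurable_alpha : measurable_fun setT alpha.
Proof. exact: continuous_measurable_fun. Qed.

Lemma measurable_kernel_diff_powR t v :
  measurable_fun setT (fun x => `|g t x - g v x| `^ alpha x).
Proof.
apply: measurable_powR_var => //; apply: measurableT_comp => //.
by apply: measurable_funB; exact: measurable_tempered_kernel.
Qed.

(** Sums of three geometric series: near annuli around each of the two singularities, and far
    annuli. *)
Definition kernel_const : R :=
  4 / (1 - 2 `^ (- (H * a))) + 4 / (1 - 2 `^ (- (H * a))) +
  (2 * (2 + a^-1)) ^+ 2 / (1 - 2 `^ (- ((1 - H) * a))).

Lemma kernel_const_ge0 : 0 <= kernel_const.
Proof.
have /andP[_ q1] := @powR2_lt1 R _ (mulr_gt0 H_gt0 a_gt0).
have H1 : 0 < 1 - H by rewrite subr_gt0.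
have /andP[_ q2] := @powR2_lt1 R _ (mulr_gt0 H1 a_gt0).
rewrite /kernel_const !addr_ge0// divr_ge0// ?sqr_ge0// subr_ge0 ltW//.
Qed.

(** If [v - x < h], then [x] lies less than [2 * h] to the left of [v + h], so both kernels are in
    the near regime. They are nonnegative, hence their distance is at most the larger one, which
    avoids any constant depending on [alpha x]. *)
Lemma kernel_diff_pointwise (h v x : R) : 0 < h ->
  ((`|g (v + h) x - g v x| `^ alpha x)%:E <=
   annuli (v + h) (near_radius h) (near_weight a b H h) x +
   annuli v (near_radius h) (near_weight a b H h) x +
   annuli v (far_radius h) (far_weight a b H h) x)%E.
Proof.
move=> h0.
have W0 : 0 <= W h by rewrite addr_ge0 ?powR_ge0.
have an0 c : (0 <= annuli c (near_radius h) (near_weight a b H h) x)%E.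
  apply: annuli_ge0 => k; first by rewrite mulr_gt0// exprn_gt0.
  by rewrite /near_weight mulr_ge0 ?exprn_ge0 ?powR_ge0//; apply: mulr_ge0.
have af0 c : (0 <= annuli c (far_radius h) (far_weight a b H h) x)%E.
  apply: annuli_ge0 => k; first by rewrite mulr_gt0// exprn_gt0.
  by rewrite /far_weight mulr_ge0 ?exprn_ge0 ?powR_ge0//; apply: mulr_ge0;
    rewrite ?sqr_ge0.
have [hs|sh] := leP h (v - x).
  apply: (le_trans (far_kernel_le a_gt0 b_le2 H_gt0 H_lt1 lambda_ge0 alpha_ab h0 hs)).
  by rewrite leeDr// adde_ge0.
apply: (@le_trans _ _ ((g (v + h) x `^ alpha x)%:E + (g v x `^ alpha x)%:E)%E); last first.
  rewrite -[leLHS]adde0 leeD// leeD//.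
    by apply: near_kernel_le => //; lra.
  by apply: near_kernel_le => //; lra.
have g1 := tempered_kernel_ge0 H alpha lambda (v + h) x.
have g2 := tempered_kernel_ge0 H alpha lambda v x.
have al0 := ltW (alpha_gt0 x).
rewrite -EFinD lee_fin; have [gg|/ltW gg] := leP (g v x) (g (v + h) x).
  rewrite ger0_norm ?subr_ge0//.
  apply: (@le_trans _ _ (g (v + h) x `^ alpha x)); last by rewrite lerDl powR_ge0.
  by apply: ge0_ler_powR => //; rewrite ?nnegrE ?subr_ge0// gerBl.
rewrite distrC ger0_norm ?subr_ge0//.
apply: (@le_trans _ _ (g v x `^ alpha x)); last by rewrite lerDr powR_ge0.
by apply: ge0_ler_powR => //; rewrite ?nnegrE ?subr_ge0// gerBl.
Qed.

Let integral_step (h v : R) : 0 < h ->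
  (\int[@lebesgue_measure R]_x (`|g (v + h) x - g v x| `^ alpha x)%:E <=
    (kernel_const * W h)%:E)%E.
Proof.
move=> h0.
have W0 : 0 <= W h by rewrite addr_ge0 ?powR_ge0.
have rn k : 0 < near_radius h k by rewrite mulr_gt0// exprn_gt0.
have rf k : 0 < far_radius h k by rewrite mulr_gt0// exprn_gt0.
have wn k : 0 <= near_weight a b H h k.
  by rewrite /near_weight mulr_ge0 ?exprn_ge0 ?powR_ge0//; apply: mulr_ge0.
have wf k : 0 <= far_weight a b H h k.
  by rewrite /far_weight mulr_ge0 ?exprn_ge0 ?powR_ge0//; apply: mulr_ge0;
    rewrite ?sqr_ge0.
have man c := @measurable_annuli R c _ _ rn wn.
have maf c := @measurable_annuli R c _ _ rf wf.
apply: (@le_trans _ _ (\int[@lebesgue_measure R]_x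
   (annuli (v + h) (near_radius h) (near_weight a b H h) x +
    annuli v (near_radius h) (near_weight a b H h) x +
    annuli v (far_radius h) (far_weight a b H h) x))%E).
  apply: ge0_le_integral => //.
  - by apply/measurable_EFinP; exact: measurable_kernel_diff_powR.
  - by apply: emeasurable_funD; [apply: emeasurable_funD; exact: man|exact: maf].
  - by move=> x _; exact: kernel_diff_pointwise.
rewrite ge0_integralD//; first last.
- exact: maf.
- by move=> x _; exact: annuli_ge0.
- by apply: emeasurable_funD; exact: man.
- by move=> x _; rewrite adde_ge0// annuli_ge0.
rewrite ge0_integralD//; first last.
- exact: man.
- by move=> x _; exact: annuli_ge0.
- exact: man.
- by move=> x _; exact: annuli_ge0.
rewrite !integral_annuli//.
have H1 : 0 < 1 - H by rewrite subr_gt0.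
have q1 := @powR2_lt1 R _ (mulr_gt0 H_gt0 a_gt0).
have q2 := @powR2_lt1 R _ (mulr_gt0 H1 a_gt0).
have s1 : 0 <= 4 * W h by exact: mulr_ge0.
have s2 : 0 <= (2 * (2 + a^-1)) ^+ 2 * W h by rewrite mulr_ge0// sqr_ge0.
rewrite /near_weight /far_weight !(nneseries_geometric s1 q1) (nneseries_geometric s2 q2).
rewrite -!EFinD lee_fin /kernel_const le_eqVlt; apply/orP; left; apply/eqP; ring.
Qed.

Lemma kernel_integral_le t v :
  (\int[@lebesgue_measure R]_x (`|g t x - g v x| `^ alpha x)%:E <=
    (kernel_const * W `|t - v|)%:E)%E.
Proof.
have [vt|tv|->] := ltgtP v t.
- rewrite gtr0_norm ?subr_gt0//.
  by have := @integral_step (t - v) v; rewrite subr_gt0 subrKC; exact.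
- rewrite distrC gtr0_norm ?subr_gt0//.
  under eq_integral do rewrite distrC.
  by have := @integral_step (v - t) t; rewrite subr_gt0 subrKC; exact.
- under eq_integral do rewrite subrr normr0 powR0//.
  by rewrite integral0 lee_fin mulr_ge0 ?kernel_const_ge0// addr_ge0 ?powR_ge0.
Qed.

(** [G] at [t] is itself the kernel difference between [t] and 0, so the increment bound already
    gives its integrability. *)
Lemma variable_Lalpha_G t : variable_Lalpha alpha (G H alpha lambda t).
Proof.
have -> : G H alpha lambda t = fun x => g t x - g 0 x.
  by apply/funext => x; rewrite G_tempered_kernel.
split; first by apply: measurable_funB; exact: measurable_tempered_kernel.
exact: le_lt_trans (kernel_integral_le t 0) (ltry _).
Qed.

End kernel_integral.

(** * From the characteristic function to tail probabilities *)

Lemma probability_le_ae d (T : measurableType d) (R : realType)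
    (P : probability T R) (A B : set T) : measurable A -> measurable B ->
  {ae P, forall w, A w -> B w} -> (P A <= P B)%E.
Proof.
move=> mA mB [N [mN N0 AB]].
apply: (@le_trans _ _ (P (B `|` N))); last first.
  by rewrite (le_trans (measureU2 _ _ _))// [X in (_ + X)%E](N0 : _ = 0%E) adde0.
apply: le_measure; rewrite ?inE//; first exact: measurableU.
move=> w Aw; have [Bw|nBw] := pselect (B w); first by left.
by right; apply: AB => /= /(_ Aw).
Qed.

Section cosine_tail.
Context d (T : measurableType d) (R : realType) (P : probability T R).
Implicit Type Z : T -> R.

Lemma measurable_cos_comp Z : measurable_fun setT Z ->
  measurable_fun setT (cos \o Z).
Proof.
move=> mZ; apply: measurableT_comp => //.
by apply: continuous_measurable_fun; exact: continuous_cos.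
Qed.

Lemma Lfun_cos Z : measurable_fun setT Z -> (cos \o Z) \in Lfun P 1%E.
Proof.
move=> mZ; apply/Lfun1_integrable; apply: (@le_integrable _ _ _ P setT measurableT _ (EFin \o cst 1)).
- by apply/measurable_EFinP; exact: measurable_cos_comp.
- by move=> w _ /=; rewrite lee_fin normr1 cos_max.
- exact: finite_measure_integrable_cst.
Qed.

Lemma cos1_lt1 : cos 1 < 1 :> R.
Proof.
rewrite -[X in _ < X]cos0 ltr_cos ?in_itv/= ?lexx ?ler01 ?pi_ge0//.
by have := @pi_ge2 R; lra.
Qed.

Lemma measurable_cos_gap Z : measurable_fun setT Z ->
  measurable [set w | 1 - cos 1 <= 1 - cos (Z w)].
Proof.
move=> mZ; rewrite -[X in measurable X]setTI.
apply: (measurable_fun_le (f := cst (1 - cos 1)) (g := fun w => 1 - cos (Z w))) => //.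
by apply: measurable_funB => //; exact: measurable_cos_comp.
Qed.

(** Markov's inequality for the nonnegative variable [1 - cos Z] at level [1 - cos 1], obtained by
    comparing with the indicator of the event. *)
Lemma markov_cos Z : measurable_fun setT Z ->
  (P [set w | (1 - cos 1 <= 1 - cos (Z w))%R] <=
    ((1 - fine 'E_P[cos \o Z]) / (1 - cos 1))%:E)%E.
Proof.
move=> mZ; set E := [set w | _]; pose c : R := 1 - cos 1; rewrite -/c.
have c0 : 0 < c by rewrite subr_gt0 cos1_lt1.
have mE : measurable E by exact: measurable_cos_gap.
have Lc := Lfun_cos mZ.
rewrite EFinM lee_pdivlMr// -(expectation_indic P mE) muleC.
rewrite -expectationZl; last first.
  by apply/Lfun1_integrable; exact: integrable_indic.
pose D : T -> R := cst 1 \- (cos \o Z).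
have -> : (1 - fine 'E_P[cos \o Z])%:E = ('E_P[D])%E.
  rewrite expectationB// ?Lfun_cst// expectation_cst EFinB fineK//.
  exact: expectation_fin_num.
apply: expectation_le.
- by apply: measurable_funM => //; exact: measurable_indic.
- by apply: measurable_funB => //; exact: measurable_cos_comp.
- by move=> w /=; rewrite mulr_ge0// ltW.
- by move=> w /=; rewrite subr_ge0 cos_le1.
apply: aeW => w /=; rewrite indicE; case: (boolP (w \in E)) => [|_].
  by rewrite inE /E/= mul1r.
by rewrite mul0r subr_ge0 cos_le1.
Qed.

(** Cosine is even and decreasing on [[0, pi]], which contains [[1, 2]]. *)
Lemma cos_gap (u : R) : 1 <= `|u| <= 2 -> 1 - cos 1 <= 1 - cos u.
Proof.
move=> /andP[u1 u2]; rewrite lerD2l lerN2 -(cos_norm u).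
move: u1; rewrite le_eqVlt => /predU1P[<-//|u1].
have p2 := @pi_ge2 R.
by apply: ltW; rewrite ltr_cos// in_itv/=; apply/andP; split; lra.
Qed.

(* Dyadic rescaling brings any [`|Y w| / y >= 1] into [[1, 2]], where the cosine
   is bounded away from 1; this replaces the usual integration of the
   characteristic function around the origin. *)
Lemma tail_le_cos (Y : T -> R) (y : R) : measurable_fun setT Y -> 0 < y ->
  (P [set w | (y <= `|Y w|)%R] <=
   \sum_(0 <= k <oo)
     ((1 - fine 'E_P[cos \o (fun w => (2^-1 ^+ k / y * Y w)%R)]) / (1 - cos 1))%:E)%E.
Proof.
move=> mY y0.
have mZ k : measurable_fun setT (fun w => (2^-1 ^+ k / y * Y w)%R).
  exact: measurable_funM.
pose F k := [set w | 1 - cos 1 <= 1 - cos (2^-1 ^+ k / y * Y w)].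
have mF k : measurable (F k) by exact: measurable_cos_gap.
apply: (@le_trans _ _ (\sum_(0 <= k <oo) P (F k))%E); last first.
  apply: lee_nneseries => [k _ _|k _]; first exact: measure_ge0.
  exact: markov_cos.
apply: measure_sigma_subadditive => //.
  rewrite -[X in measurable X]setTI.
  apply: (measurable_fun_le (f := cst y) (g := fun w => `|Y w|)) => //.
  exact: measurableT_comp.
move=> w /= yY.
have [|k [kl ku]] := @dyadic_interval R (`|Y w| / y).
  by rewrite ler_pdivlMr// mul1r.
exists k => //; rewrite /F/=; apply: cos_gap.
rewrite !normrM normrX normfV (gtr0_norm (_ : 0 < 2))// normfV (gtr0_norm y0).
have -> : 2^-1 ^+ k / y * `|Y w| = (`|Y w| / y) / 2 ^+ k by rewrite exprVn; ring.
by rewrite ler_pdivlMr ?exprn_gt0// mul1r kl/= ler_pdivrMr ?exprn_gt0.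
Qed.

End cosine_tail.

(** * Tail bound for the increments of the motion *)

(** The real part of the two-dimensional characteristic function with coefficients [theta] and
    [- theta]. *)
Lemma multistable_increment_cos d (T : measurableType d) (R : realType)
    (P : probability T R) (alpha : R -> R) (I : (R -> R) -> {RV P >-> R})
    (f1 f2 : R -> R) (theta : R) :
  multistable_integral alpha I ->
  variable_Lalpha alpha f1 -> variable_Lalpha alpha f2 ->
  fine 'E_P[cos \o (fun w => (theta * (I f1 w - I f2 w))%R)] =
  expR (- \int[@lebesgue_measure R]_x (`|theta * (f1 x - f2 x)| `^ alpha x)).
Proof.
move=> hI L1 L2.
have := hI 2 (fun k => if k == ord0 then f1 else f2)
  (fun k => if k == ord0 then theta else - theta).
have -> : (fun w : T => \sum_(k < 2) (if k == ord0 then theta else - theta) *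
    I (if k == ord0 then f1 else f2) w) =
    (fun w => (theta * (I f1 w - I f2 w))%R).
  by apply/funext => w; rewrite !big_ord_recl big_ord0/= addr0 mulNr -mulrBr.
have -> : (fun x : R => `|\sum_(k < 2) (if k == ord0 then theta else - theta) *
    (if k == ord0 then f1 else f2) x| `^ alpha x) =
    (fun x => `|theta * (f1 x - f2 x)| `^ alpha x).
  by apply/funext => x; rewrite !big_ord_recl big_ord0/= addr0 mulNr -mulrBr.
move=> /(_ _)/eqP; rewrite /expectation_expi eq_complex/= => h.
by apply/eqP; case/andP: (h (fun k => if k == ord0 as c return
  variable_Lalpha alpha (if c then f1 else f2) then L1 else L2)).
Qed.

Lemma measurable_norm_ge d (T : measurableType d) (R : realType)
    (P : probability T R) (X Y : {RV P >-> R}) (y : R) :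
  measurable [set w | y <= `|X w - Y w|].
Proof.
rewrite -[X in measurable X]setTI.
apply: (measurable_fun_le (f := cst y) (g := fun w => `|X w - Y w|)) => //.
by apply: measurableT_comp => //; exact: measurable_funB.
Qed.

Section increments.
Context {R : realType}.
Variables (a b H lambda : R).
Hypotheses (a_gt0 : 0 < a) (b_le2 : b <= 2) (H_gt0 : 0 < H) (H_lt1 : H < 1)
  (lambda_ge0 : 0 <= lambda).

Local Notation W h := (h `^ (H * a) + h `^ (H * b)).

Definition tail_const : R :=
  kernel_const a H / (1 - cos 1) / (1 - 2 `^ (- a)).

Lemma tail_const_ge0 : 0 <= tail_const.
Proof.
have /andP[_ q1] := @powR2_lt1 R _ a_gt0.
rewrite /tail_const !divr_ge0 ?kernel_const_ge0// subr_ge0 ltW//.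
Qed.

Lemma one_sub_cos_increment_le d (T : measurableType d) (P : probability T R)
    (alpha : R -> R) (I : (R -> R) -> {RV P >-> R}) (t v y : R) (k : nat) :
  (forall x, a <= alpha x <= b) -> continuous alpha ->
  multistable_integral alpha I -> 0 < y ->
  1 - fine 'E_P[cos \o (fun w => (2^-1 ^+ k / y *
      (I (G H alpha lambda t) w - I (G H alpha lambda v) w))%R)] <=
  kernel_const a H * W `|t - v| / Num.min (y `^ a) (y `^ b) *
    (2 `^ (- a)) ^+ k.
Proof.
move=> al cal hI y0.
have LG s := variable_Lalpha_G a_gt0 b_le2 H_gt0 H_lt1 lambda_ge0 al cal s.
rewrite (multistable_increment_cos _ hI (LG t) (LG v)).
set J := Rintegral _ _ _.
apply: (@le_trans _ _ J); first by have := expR_ge1Dx (- J); lra.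
set m := Num.min _ _.
have m0 : 0 < m by rewrite lt_min !powR_gt0.
have al0 x : 0 < alpha x by case/andP: (al x) => /(lt_le_trans a_gt0).
pose g := tempered_kernel H alpha lambda.
have mg : measurable_fun setT (fun x : R => (`|g t x - g v x| `^ alpha x)%:E).
  apply/measurable_EFinP.
  exact: (measurable_kernel_diff_powR H lambda a_gt0 al cal t v).
have q0 : 0 <= (2 `^ (- a)) ^+ k / m :> R.
  by rewrite divr_ge0 ?exprn_ge0 ?powR_ge0// ltW.
have IJ : (\int[@lebesgue_measure R]_x
    (`|2^-1 ^+ k / y * (G H alpha lambda t x - G H alpha lambda v x)| `^ alpha x)%:E
    <= ((2 `^ (- a)) ^+ k / m * (kernel_const a H * W `|t - v|))%:E)%E.
  rewrite EFinM; apply: le_trans; last first.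
    apply: lee_wpmul2l; last exact: (kernel_integral_le a_gt0 b_le2 H_gt0 H_lt1
      lambda_ge0 al cal t v).
    by rewrite lee_fin.
  rewrite -ge0_integralZl//.
  apply: ge0_le_integral => //.
  - apply/measurable_EFinP; apply: measurable_powR_var => [x||].
    + by rewrite gt_eqF.
    + apply: measurableT_comp => //; apply: measurable_funM => //.
      by apply: measurable_funB; case: (LG t) (LG v) => ? _ [].
    + exact: continuous_measurable_fun.
  - exact: emeasurable_funM.
  move=> x _; rewrite -EFinM lee_fin tempered_kernelB normrM powRM//.
  rewrite ler_wpM2r ?powR_ge0// ger0_norm; last first.
    by rewrite divr_ge0 ?exprn_ge0// ltW.
  rewrite powRM ?exprn_ge0 ?invr_ge0 ?(ltW y0)//.
  apply: ler_pM; rewrite ?powR_ge0//.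
    by apply: powR_half_exp; case/andP: (al x).
  rewrite -(powR_inv1 (ltW y0)) -powRrM mulN1r powRN lef_pV2 ?posrE ?powR_gt0//.
  exact: powR_ge_min.
have -> : kernel_const a H * W `|t - v| / m * (2 `^ (- a)) ^+ k =
   (2 `^ (- a)) ^+ k / m * (kernel_const a H * W `|t - v|) by ring.
(* The real integral is the [fine] part of the extended one, so the comparison requires finiteness,
   which [IJ] supplies. *)
rewrite -lee_fin /J fineK//.
rewrite ge0_fin_numE ?(le_lt_trans IJ (ltry _))//.
by apply: integral_ge0 => x _; rewrite lee_fin powR_ge0.
Qed.

Lemma LTFmSM_tail d (T : measurableType d) (P : probability T R)
    (alpha : R -> R) (X : R -> {RV P >-> R}) :
  (forall x, a <= alpha x <= b) -> continuous alpha ->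
  LTFmSM H alpha lambda X ->
  forall t v y : R, 0 < y ->
  (P [set w | (y <= `|X t w - X v w|)%R] <=
    (tail_const / Num.min (y `^ a) (y `^ b) * W `|t - v|)%:E)%E.
Proof.
move=> al cal [I hI XI] t v y y0.
pose Z w := I (G H alpha lambda t) w - I (G H alpha lambda v) w.
(* [X] agrees with the stochastic integral only almost surely at each time; two null sets are
   discarded. *)
apply: (@le_trans _ _ (P [set w | y <= `|Z w|])).
  apply: probability_le_ae; [exact: measurable_norm_ge|exact: measurable_norm_ge|].
  move: (XI t) (XI v); apply: filterS2 => w /= Xt Xv.
  by rewrite Xt Xv.
have c0 : 0 < 1 - cos 1 :> R by rewrite subr_gt0 cos1_lt1.
apply: le_trans; first by apply: tail_le_cos => //; exact: measurable_funB.
pose s : R := kernel_const a H * W `|t - v| / Num.min (y `^ a) (y `^ b) / (1 - cos 1).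
have s0 : 0 <= s.
  rewrite /s divr_ge0 ?(ltW c0)// divr_ge0//; last by rewrite le_min !powR_ge0.
  by apply: mulr_ge0; [exact: kernel_const_ge0|rewrite addr_ge0 ?powR_ge0].
apply: (@le_trans _ _ (\sum_(0 <= k <oo) (s * (2 `^ (- a)) ^+ k)%:E)%E).
  apply: lee_nneseries => k _ => [_|].
    apply: le_trans (measure_ge0 P _) (markov_cos _ _).
    by apply: measurable_funM => //; exact: measurable_funB.
  rewrite lee_fin /s -!mulrA (mulrC (1 - cos 1)^-1) !mulrA ler_wpM2r ?invr_ge0 ?(ltW c0)//.
  exact: one_sub_cos_increment_le.
rewrite nneseries_geometric ?powR2_lt1// lee_fin /s /tail_const.
by rewrite le_eqVlt; apply/orP; left; apply/eqP; ring.
Qed.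

End increments.

(** * Small increments and stochastic Hölder continuity *)

Section small_increments.
Context {R : realType}.
Variables (a b H lambda : R).
Hypotheses (a_gt0 : 0 < a) (a_le_b : a <= b) (b_le2 : b <= 2) (H_gt0 : 0 < H)
  (H_lt1 : H < 1) (lambda_ge0 : 0 <= lambda).
Context d (T : measurableType d) (P : probability T R).
Variables (alpha : R -> R) (X : R -> {RV P >-> R}).
Hypotheses (alpha_ab : forall x, a <= alpha x <= b) (alpha_cont : continuous alpha)
  (X_LTFmSM : LTFmSM H alpha lambda X).

Lemma LTFmSM_tail_small (beta t v : R) : 0 < beta -> 0 < `|t - v| -> `|t - v| <= 1 ->
  (P [set w | (`|t - v| `^ beta <= `|X t w - X v w|)%R] <=
    (2 * tail_const a H * `|t - v| `^ (H * a - beta * b))%:E)%E.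
Proof.
move=> beta0; set h := `|t - v| => h0 h1.
have h01 : 0 < h <= 1 by rewrite h0.
have y0 : 0 < h `^ beta by exact: powR_gt0.
apply: le_trans (LTFmSM_tail a_gt0 b_le2 H_gt0 H_lt1 lambda_ge0 alpha_ab
  alpha_cont X_LTFmSM t v y0) _.
rewrite -/h lee_fin.
have C0 : 0 <= tail_const a H by exact: tail_const_ge0.
have -> : Num.min ((h `^ beta) `^ a) ((h `^ beta) `^ b) = h `^ (beta * b).
  rewrite -!powRrM min_r//; apply: ger_powR => //.
  by rewrite ler_pM2l.
rewrite -mulrA [leRHS](_ : _ =
    tail_const a H * ((h `^ (beta * b))^-1 * (2 * h `^ (H * a)))); last first.
  by rewrite powRB ?(gt_eqF h0) ?implybT//; ring.
rewrite ler_wpM2l// ler_wpM2l ?invr_ge0 ?powR_ge0//.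
have : h `^ (H * b) <= h `^ (H * a) by apply: ger_powR => //; rewrite ler_pM2l.
lra.
Qed.

Lemma LTFmSM_stochastic_Holder (beta : R) : 0 < beta -> beta < H * a / b ->
  stochastic_Holder setT X beta.
Proof.
move=> beta0 betab; exists 1 => //.
have b0 : 0 < b by exact: lt_le_trans a_le_b.
have g0 : 0 < H * a - beta * b by rewrite subr_gt0 -ltr_pdivlMr.
set gam := H * a - beta * b in g0.
have C0 : 0 <= tail_const a H by exact: tail_const_ge0.
apply/eqP; rewrite eq_le; apply/andP; split.
  apply/lee_addgt0Pr => e e0; rewrite add0e.
  pose q : R := e / (2 * tail_const a H + 1).
  have q0 : 0 < q by rewrite divr_gt0//; lra.
  pose dl := Num.min 1 (q `^ gam^-1).
  have dl0 : 0 < dl by rewrite lt_min ltr01 powR_gt0.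
  pose V := [set p : R * R | p.1 != p.2 /\ `|p.1 - p.2| < dl].
  apply: (@le_trans _ _ (ereal_sup [set P [set w |
    1 * `|p.1 - p.2| `^ beta <= `|X p.1 w - X p.2 w|] | p in V])).
    apply: ereal_inf_lbound; exists V => //.
    rewrite /within/=; have := @entourage_ball R R (PosNum dl0).
    by apply: filterS => p pd [_ _ pp]; split.
  apply: ge_ereal_sup => _ [[t v] [/= tv htv] <-]; rewrite mul1r.
  have h0 : 0 < `|t - v| by rewrite normr_gt0 subr_eq0.
  move: htv; rewrite lt_min => /andP[/ltW h1 hq].
  apply: (le_trans (LTFmSM_tail_small beta0 h0 h1)); rewrite lee_fin -/gam.
  have hg : `|t - v| `^ gam <= q.
    have -> : q = (q `^ gam^-1) `^ gam by rewrite -powRrM mulVf ?gt_eqF// powRr1// ltW.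
    by apply: ge0_ler_powR; rewrite ?nnegrE ?powR_ge0// ltW.
  apply: (@le_trans _ _ (2 * tail_const a H * q)).
    by rewrite ler_wpM2l// mulr_ge0.
  rewrite /q mulrA ler_pdivrMr; last by lra.
  by rewrite mulrC ler_wpM2l ?(ltW e0)//; lra.
(* The lower bound needs every set of the filter to be nonempty, as an empty supremum is [-oo]; the
   distinct pair [(e / 2, 0)] is a member. *)
apply: le_ereal_inf_tmp => _ [V FV <-].
move: FV; rewrite /within/= -entourage_ballE => -[e /= e0 eV].
have V0 : V (e / 2, 0).
  apply: eV; last by split => //=; rewrite mulf_neq0// ?invr_neq0// gt_eqF.
  by rewrite /ball/= subr0 ger0_norm; lra.
apply: le_trans (measure_ge0 P _) (ereal_sup_ubound _).
by exists (e / 2, 0).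
Qed.

End small_increments.

Theorem proposition6 (R : realType) (a b H lambda : R)
    (a_gt0 : 0 < a) (a_le_b : a <= b) (b_le2 : b <= 2)
    (H_gt0 : 0 < H) (H_lt1 : H < 1) (lambda_gt0 : 0 < lambda) :
  [/\
    exists C : R,
      forall (d : measure_display) (T : measurableType d)
        (P : probability T R) (alpha : R -> R) (X : R -> {RV P >-> R}),
        (forall x, a <= alpha x <= b) -> continuous alpha ->
        LTFmSM H alpha lambda X ->
        forall t v y : R, 0 < y ->
          (P [set w | (y <= `|X t w - X v w|)%R] <=
             (C / Num.min (y `^ a) (y `^ b)
                * (`|t - v| `^ (H * a) + `|t - v| `^ (H * b)))%:E)%E,
    exists C : R,
      forall (d : measure_display) (T : measurableType d)
        (P : probability T R) (alpha : R -> R) (X : R -> {RV P >-> R}),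
        (forall x, a <= alpha x <= b) -> continuous alpha ->
        LTFmSM H alpha lambda X ->
        forall beta t v : R, 0 < beta -> beta < H * a / b ->
          0 < `|t - v| -> `|t - v| <= 1 ->
          (P [set w | (`|t - v| `^ beta <= `|X t w - X v w|)%R] <=
             (C * `|t - v| `^ (H * a - beta * b))%:E)%E
  & forall (d : measure_display) (T : measurableType d)
      (P : probability T R) (alpha : R -> R) (X : R -> {RV P >-> R}),
      (forall x, a <= alpha x <= b) -> continuous alpha ->
      LTFmSM H alpha lambda X ->
      forall beta : R, 0 < beta -> beta < H * a / b ->
        stochastic_Holder setT X beta
  ].

Proof.
have lambda_ge0 := ltW lambda_gt0.
split.
- exists (tail_const a H) => d T P alpha X al cal LX t v y y0.
  exact: (LTFmSM_tail a_gt0 b_le2 H_gt0 H_lt1 lambda_ge0 al cal LX).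
- exists (2 * tail_const a H) => d T P alpha X al cal LX beta t v beta0 _ h0 h1.
  exact: (LTFmSM_tail_small a_gt0 a_le_b b_le2 H_gt0 H_lt1 lambda_ge0 al cal LX).
- move=> d T P alpha X al cal LX beta beta0 betab.
  exact: (LTFmSM_stochastic_Holder a_gt0 a_le_b b_le2 H_gt0 H_lt1 lambda_ge0 al cal LX).
Qed.
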